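(* Let $0<p<1$ be a fixed real number, and for each positive integer $n$ let $X_{n,p}$ be the number of cliques (maximal complete subgraphs) in the Erdős–Rényi random graph $G(n,p)$. Then, as $n\to\infty$, $$\mathbb{E}[X_{n,p}] = n^{\frac{1}{-2\log p}\left(\log n-2\log\log n+O(1)\right)}.$$ That is, there are constants $C>0$ and $n_0\ge 3$, depending only on $p$, such that for every integer $n\ge n_0$ there is a real number $\varepsilon_n$ with $|\varepsilon_n|\le C$ and $\mathbb{E}[X_{n,p}]=n^{\frac{1}{-2\log p}(\log n-2\log\log n+\varepsilon_n)}$.
   Context: $G(n,p)$ is the random graph on $n$ labelled vertices in which each of the $\binom n2$ possible edges occurs independently with probability $p$. A clique of a graph means a maximal (with respect to inclusion) complete subgraph, i.e. a nonempty set of pairwise adjacent vertices not properly contained in another set of pairwise adjacent vertices. $\log$ denotes the natural logarithm. *)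

(* Defs.v *)
From HB Require Import structures.
From mathcomp Require Export all_boot all_order all_algebra.
From mathcomp Require Export reals exp.

Set Implicit Arguments.
Unset Strict Implicit.
Unset Printing Implicit Defensive.

Import Order.TTheory GRing.Theory Num.Theory.
Local Open Scope ring_scope.

(* The 'C(n, 2) possible edges on the vertex set 'I_n. *)
Definition edge (n : nat) := {e : {set 'I_n} | #|e| == 2%N}.

(* A simple graph on 'I_n is the set of its edges; no loop is possible since
   an edge has two distinct endpoints. *)
Definition graph (n : nat) := {set edge n}.

Definition adjacent n (G : graph n) (x y : 'I_n) : bool :=
  [exists e in G, val e == [set x; y]].

Definition pairwise_adjacent n (G : graph n) (S : {set 'I_n}) : bool :=
  [forall x in S, forall y in S, (x != y) ==> adjacent G x y].

(* Cliques are maximal with respect to inclusion. *)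
Definition clique n (G : graph n) (S : {set 'I_n}) : bool :=
  (S != set0) && maxset (pairwise_adjacent G) S.

Definition num_cliques n (G : graph n) : nat := #|[set S | clique G S]|.

(* The probability of the outcome G in G(n,p): the product of the
   Bernoulli(p) weights of the possible edges. *)
Definition Gnp_mass (R : realType) n (p : R) (G : graph n) : R :=
  \prod_(e : edge n) (if e \in G then p else 1 - p).

Definition Gnp_expectation (R : realType) n (p : R) (X : graph n -> R) : R :=
  \sum_(G : graph n) Gnp_mass p G * X G.

Lemma card_edge n : #|{: edge n}| = 'C(n, 2).
Proof.
rewrite card_sig -[X in 'C(X, _)](card_ord n) -card_draws.
by apply: eq_card => e; rewrite !inE.
Qed.

Lemma Gnp_mass_ge0 (R : realType) n (p : R) (G : graph n) :
  0 <= p <= 1 -> 0 <= Gnp_mass p G.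
Proof.
case/andP=> p0 p1; apply: prodr_ge0 => e _.
by case: ifP => // _; rewrite subr_ge0.
Qed.

Lemma Gnp_mass_sum1 (R : realType) n (p : R) :
  \sum_(G : graph n) Gnp_mass p G = 1.
Proof.
rewrite -(bigA_distr _ _ (fun=> p) (fun=> 1 - p)).
by apply: big1 => e _; rewrite /= addrC subrK.
Qed.

(* The edges are independent, each present with probability p. *)
Lemma Gnp_edges_independent (R : realType) n (p : R) (A : {set edge n}) :
  Gnp_expectation p (fun G : graph n => (A \subset G)%:R) = p ^+ #|A|.
Proof.
transitivity
    (\prod_(e : edge n) (p + (if e \in A then 0 else 1 - p))); last first.
  rewrite -prodr_const [RHS]big_mkcond; apply: eq_bigr => e _.
  by case: ifP => _; rewrite ?addr0 // addrC subrK.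
rewrite bigA_distr; apply: eq_bigr => G _.
have [AG | /subsetPn[e eA eG]] := boolP (A \subset G).
  rewrite mulr1; apply: eq_bigr => e _; case: ifP => // eG.
  by case: ifP => // /(subsetP AG); rewrite eG.
by rewrite mulr0 [RHS](bigD1 e) //= (negPf eG) eA mul0r.
Qed.

(* Main.v *)
Require Import Defs.
From mathcomp Require Import sequences ring lra.

Set Implicit Arguments.
Unset Strict Implicit.
Unset Printing Implicit Defensive.

Import Order.TTheory GRing.Theory Num.Theory.
Local Open Scope ring_scope.

(** Write [L = ln n], [lam = - ln p] and [l = ln L].

    A nonempty set [S] of [k] vertices is a clique when its ['C(k, 2)] inner
    edges are all present and no outside vertex is joined to all of [S].  These
    events concern disjoint sets of edges, so [S] is a clique with probability
    [p ^+ 'C(k, 2) * (1 - p ^+ k) ^+ (n - k)], and [E X] is the sum of these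
    numbers over all nonempty [S] ([Gnp_expectation_num_cliques]).  It remains
    to estimate that sum up to a factor [expR (O(L))].

    Upper bound.  Maximality can be forgotten: the second factor is at most 1.
    Completing the square gives
    [p ^+ 'C(k, 2) * (n / L) ^+ k <= expR ((L - l + lam / 2) ^+ 2 / (2 * lam))]
    for every [k], and the weights [(L / n) ^+ #|S|] sum to
    [(1 + L / n) ^+ n <= expR L].  The ratio [n / L] is, up to a constant
    factor, the value of [n / k] at the size [k ~ L / lam] that dominates the
    sum, so that this detour around the binomial coefficients loses only a
    factor [expR (O(L))].  Since [l ^+ 2 = O(L)], the
    exponent is [(L ^+ 2 - 2 * L * l + O(L)) / (2 * lam)].

    Lower bound.  Keep only the sets of size [k], the least integer above
    [L / lam].  Then [p ^+ k <= 1 / n], so that maximality costs at most a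
    factor [expR 1]; there are ['C(n, k) >= (n / k) ^+ k] such sets, and
    [p ^+ 'C(k, 2) >= expR (- k * L / 2)] because [lam * (k - 1) <= L].  Hence
    [ln (E X) >= k * L / 2 - k * ln k - 1], and the right-hand side is
    [(L ^+ 2 - 2 * L * l + O(L)) / (2 * lam)] as well. *)

(** * Independence over disjoint sets of edges *)

(** Edge sets that are pairwise disjoint behave independently.  Letting [A]
    grow makes this an induction on [s]: the indicator of [A] times one minus
    that of [D v] is the indicator of [A] minus that of [A :|: D v], and each
    of the two terms is an instance of the claim for a shorter sequence. *)
Lemma Gnp_expectation_avoid (R : realType) n (p : R) (V : eqType)
    (D : V -> {set edge n}) (s : seq V) (A : {set edge n}) :
    all (fun v => [disjoint A & D v]) s ->
    pairwise (fun v w => [disjoint D v & D w]) s ->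
  Gnp_expectation p (fun G : graph n =>
      (A \subset G)%:R * \prod_(v <- s) (1 - (D v \subset G)%:R)) =
    p ^+ #|A| * \prod_(v <- s) (1 - p ^+ #|D v|).
Proof.
elim: s A => [|v s IHs] A /=.
  move=> _ _; rewrite big_nil mulr1 -Gnp_edges_independent.
  by apply: eq_bigr => G _; rewrite big_nil mulr1.
case/andP=> ADv ADs /andP[DvDs Ds].
have AUDv : all (fun w => [disjoint A :|: D v & D w]) s.
  apply/allP=> w ws; rewrite -setI_eq0 setIUl setU_eq0 !setI_eq0 (allP ADs) //=.
  by have /allP := DvDs; apply.
have cardAUDv : #|A :|: D v| = (#|A| + #|D v|)%N.
  by apply/eqP; rewrite (leq_card_setU A (D v)).2.
transitivity (Gnp_expectation p (fun G : graph n => (A \subset G)%:R *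
      \prod_(w <- s) (1 - (D w \subset G)%:R)) -
    Gnp_expectation p (fun G : graph n => (A :|: D v \subset G)%:R *
      \prod_(w <- s) (1 - (D w \subset G)%:R))).
  rewrite -sumrB; apply: eq_bigr => G _; rewrite -mulrBr -mulrBl; congr (_ * _).
  by rewrite big_cons subUset -mulnb natrM mulrA mulrBr mulr1.
by rewrite (IHs A) // (IHs (A :|: D v)) // cardAUDv exprD big_cons mulrA
  mulrBr mulr1 mulrBl.
Qed.

(** * The probability of being a clique *)

Definition edges_within n (S : {set 'I_n}) : {set edge n} :=
  [set e : edge n | val e \subset S].

(** For [v] outside [S] these are the edges joining [v] to [S].  As a difference
    of two sets of inner edges, their number and their disjointness follow
    from those of the inner edges, with no explicit enumeration. *)
Definition star n (S : {set 'I_n}) (v : 'I_n) : {set edge n} :=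
  edges_within (v |: S) :\: edges_within S.

Lemma card_edges_within n (S : {set 'I_n}) : #|edges_within S| = 'C(#|S|, 2).
Proof.
rewrite -cards_draws -(card_imset _ val_inj); apply: eq_card => A.
rewrite inE; apply/imsetP/andP=> [[e + ->]|[AS A2]].
  by rewrite inE => ->; rewrite (valP e).
by exists (Sub A A2 : edge n); rewrite ?inE SubK.
Qed.

Lemma edges_withinS n (S T : {set 'I_n}) :
  S \subset T -> edges_within S \subset edges_within T.
Proof. by move=> ST; apply/subsetP=> e; rewrite !inE => /subset_trans->. Qed.

Lemma card_star n (S : {set 'I_n}) v : v \notin S -> #|star S v| = #|S|.
Proof.
move=> vS; have sI : edges_within S \subset edges_within (v |: S).
  exact/edges_withinS/subsetUr.
by rewrite cardsDS // !card_edges_within cardsU1 vS add1n binS bin1 addKn.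
Qed.

Lemma disjoint_star n (S : {set 'I_n}) v w :
  v != w -> [disjoint star S v & star S w].
Proof.
move=> vw; rewrite -setI_eq0; apply/eqP/setP=> e; rewrite !inE.
apply/negP=> /andP[/andP[/negP neS /subsetP ev] /andP[_ /subsetP ew]].
apply: neS.
apply/subsetP=> x xe; have:= ev x xe; have:= ew x xe; rewrite !inE.
by case: (x =P v) => // ->; rewrite (negPf vw).
Qed.

Lemma pairwise_adjacentE n (G : graph n) S :
  pairwise_adjacent G S = (edges_within S \subset G).
Proof.
apply/idP/subsetP=> [adjS e | SG].
  rewrite inE => /subsetP eS; have /cards2P[x [y [xy def_e]]] := valP e.
  have [xS yS] : x \in S /\ y \in S.
    by split; apply: eS; rewrite def_e !inE eqxx ?orbT.
  move/forall_inP/(_ x xS)/forall_inP/(_ y yS)/implyP/(_ xy): adjS.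
  case/exists_inP=> f fG /eqP def_f; rewrite (_ : e = f) //.
  by apply: val_inj; rewrite /= def_e.
apply/forall_inP=> x xS; apply/forall_inP=> y yS; apply/implyP=> xy.
have xy2 : #|[set x; y]| == 2 by rewrite cards2 xy.
apply/exists_inP; exists (Sub [set x; y] xy2 : edge n); rewrite ?SubK //.
by apply: SG; rewrite inE SubK subUset !sub1set xS.
Qed.

(** It suffices to test maximality against one extra vertex, since a subset of
    a set of pairwise adjacent vertices is again pairwise adjacent. *)
Lemma cliqueE n (G : graph n) S : clique G S =
  [&& S != set0, edges_within S \subset G
    & [forall v in ~: S, ~~ (star S v \subset G)]].
Proof.
rewrite /clique; congr (_ && _).
apply/maxsetP/andP=> [[] | [SG /forall_inP maxS]].
  rewrite pairwise_adjacentE => SG maxS; split=> //.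
  apply/forall_inP=> v; rewrite inE => vS; apply/negP=> starG.
  case/negP: vS; rewrite -(maxS (v |: S)) ?setU11 ?subsetUr //.
  rewrite pairwise_adjacentE -(setID (edges_within _) (edges_within S)).
  by rewrite subUset starG subIset ?SG ?orbT.
rewrite pairwise_adjacentE; split=> // T; rewrite pairwise_adjacentE => TG ST.
apply/eqP; rewrite eqEsubset ST andbT; apply/subsetP=> v vT.
apply/negPn/negP=> vS.
have vS' : v \in ~: S by rewrite inE.
have /negP := maxS v vS'; apply.
apply: subset_trans TG; apply: (subset_trans (subsetDl _ _)).
apply: edges_withinS.
by rewrite subUset sub1set vT.
Qed.

(** The inner edges of [S] and the stars of the outside vertices are pairwise
    disjoint, so the requirements in [cliqueE] are independent. *)
Lemma Gnp_clique_probability (R : realType) n (p : R) (S : {set 'I_n}) :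
    S != set0 ->
  Gnp_expectation p (fun G : graph n => (clique G S)%:R) =
    p ^+ 'C(#|S|, 2) * (1 - p ^+ #|S|) ^+ (n - #|S|).
Proof.
move=> S0; pose s := enum (~: S).
have vs v : v \in s -> v \notin S by rewrite mem_enum inE.
transitivity (Gnp_expectation p (fun G : graph n =>
    (edges_within S \subset G)%:R *
    \prod_(v <- s) (1 - (star S v \subset G)%:R))).
  apply: eq_bigr => G _; congr (_ * _).
  rewrite cliqueE S0 andTb -mulnb natrM; congr (_ * _); rewrite /s big_enum /=.
  have [/forall_inP allF|] :=
      boolP [forall v in ~: S, ~~ (star S v \subset G)].
    by rewrite big1 // => v /allF/negPf->; rewrite subr0.
  rewrite negb_forall => /existsP[v].
  rewrite negb_imply negbK => /andP[vS vG].
  by rewrite (bigD1 v) //= vG subrr mul0r.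
rewrite Gnp_expectation_avoid ?card_edges_within.
- congr (_ * _).
  rewrite (eq_big_seq (fun=> 1 - p ^+ #|S|)) => [|v /vs vS]; last first.
    by rewrite card_star.
  by rewrite big_const_seq count_predT /s -cardE cardsCs setCK card_ord
    iter_mulr_1.
- apply/allP=> v _.
  by rewrite disjoints_subset /star setDE setCI setCK subsetUr.
have := enum_uniq (~: S); rewrite uniq_pairwise; apply: sub_pairwise => v w.
exact: disjoint_star.
Qed.

Lemma Gnp_expectation_num_cliques (R : realType) n (p : R) :
  Gnp_expectation p (fun G : graph n => (num_cliques G)%:R) =
    \sum_(S : {set 'I_n} | S != set0)
      p ^+ 'C(#|S|, 2) * (1 - p ^+ #|S|) ^+ (n - #|S|).
Proof.
transitivity (\sum_(S : {set 'I_n} | S != set0)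
    Gnp_expectation p (fun G : graph n => (clique G S)%:R)); last first.
  by apply: eq_bigr => S S0; rewrite Gnp_clique_probability.
rewrite exchange_big; apply: eq_bigr => G _; rewrite -mulr_sumr; congr (_ * _).
rewrite /num_cliques -sum1_card natr_sum big_mkcond [RHS]big_mkcond.
apply: eq_bigr => S _; rewrite inE /clique.
by case: (S == set0) => //=; case: ifP.
Qed.

(** * Bounds on the expectation *)

Lemma natr_bin2 (R : realType) k : 'C(k, 2)%:R = k%:R * (k%:R - 1) / 2 :> R.
Proof.
elim: k => [|k IHk]; first by rewrite !mul0r.
by rewrite binS bin1 natrD IHk -natr1; field.
Qed.

Lemma exprn_ln (R : realType) (x : R) k : 0 < x -> x ^+ k = expR (k%:R * ln x).
Proof. by move=> x0; rewrite expRM_natl lnK. Qed.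

(** This replaces a sum over sizes with binomial coefficients. *)
Lemma sum_exp_card (R : comNzRingType) n (x : R) :
  \sum_(S : {set 'I_n}) x ^+ #|S| = (1 + x) ^+ n.
Proof.
rewrite addrC -[in RHS](card_ord n) -prodr_const.
rewrite [RHS](bigA_distr _ _ (fun=> x) (fun=> 1)); apply: eq_bigr => S _.
by rewrite -big_mkcond prodr_const.
Qed.

(** Each set [S] contributes at most a constant [expR M] times the weight
    [(L / n) ^+ #|S|], and these weights sum to at most [expR L]. *)
Lemma Gnp_expectation_num_cliques_le (R : realType) n (p : R) :
    0 < p -> p < 1 -> 1 <= ln n%:R :> R ->
  Gnp_expectation p (fun G : graph n => (num_cliques G)%:R) <=
    expR (ln n%:R + (ln n%:R - ln (ln n%:R) - ln p / 2) ^+ 2 / (- 2 * ln p)).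
Proof.
move=> p0 p1; set L := ln n%:R => L1.
have L0 : 0 < L by lra.
have n0 : 0 < n%:R :> R.
  by rewrite ltNge; apply/negP => /ln0; rewrite -/L; lra.
have lnp : ln p < 0 by rewrite -[0]ln1 ltr_ln ?posrE.
set M := _ / (- 2 * ln p).
have term_le (S : {set 'I_n}) :
    p ^+ 'C(#|S|, 2) * (1 - p ^+ #|S|) ^+ (n - #|S|) <=
      expR M * (L / n%:R) ^+ #|S|.
  have pS0 : 0 <= p ^+ #|S| by rewrite exprn_ge0 // ltW.
  have pS1 : p ^+ #|S| <= 1 by rewrite exprn_ile1 // ltW.
  apply: (@le_trans _ _ (p ^+ 'C(#|S|, 2))).
    apply: ler_piMr; first by rewrite exprn_ge0 // ltW.
    by apply: exprn_ile1; lra.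
  rewrite !exprn_ln ?divr_gt0 // -expRD ler_expR natr_bin2.
  rewrite lnM ?posrE ?invr_gt0 // lnV ?posrE // -/L.
  set k : R := #|S|%:R.
  (* Completing the square in k: the first summand is nonnegative. *)
  have -> : M = (L - ln L - ln p / 2 + k * ln p) ^+ 2 / (- 2 * ln p)
      + k * (L - ln L - ln p / 2) + k ^+ 2 * ln p / 2.
    by rewrite /M; field; rewrite lt_eqF.
  suff : 0 <= (L - ln L - ln p / 2 + k * ln p) ^+ 2 / (- 2 * ln p) by lra.
  by rewrite divr_ge0 ?sqr_ge0 //; lra.
rewrite Gnp_expectation_num_cliques.
apply: (@le_trans _ _ (\sum_(S : {set 'I_n}) expR M * (L / n%:R) ^+ #|S|)).
  rewrite [leRHS](bigID (fun S : {set 'I_n} => S != set0)) /= -[leLHS]addr0.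
  apply: lerD; first exact: ler_sum.
  apply: sumr_ge0 => S _; rewrite mulr_ge0 ?expR_ge0 // exprn_ge0 //.
  by rewrite divr_ge0 // ltW.
rewrite -mulr_sumr sum_exp_card expRD mulrC ler_wpM2r ?expR_ge0 //.
rewrite -[X in expR X](divfK (lt0r_neq0 n0)) expRM_natr.
by rewrite lerXn2r ?nnegrE ?expR_ge0 ?expR_ge1Dx // addr_ge0 // divr_ge0 // ltW.
Qed.

(** This is ['C(n, k) >= (n / k) ^ k].  In the inductive step ['C(n, k)] is
    multiplied by [n.+1 / k.+1], and [n.+1 / k.+1 <= n / k] as [k <= n]. *)
Lemma expn_le_bin n k : (k <= n)%N -> (n ^ k <= k ^ k * 'C(n, k))%N.
Proof.
elim: k n => [|k IHk] [|n] // kn; rewrite ?bin0 //.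
rewrite [(k.+1 ^ k.+1)%N]expnSr -mulnA -mul_bin_diag /= mulnCA expnS.
rewrite leq_mul2l /=.
have kk0 : (0 < k ^ k)%N by rewrite expn_gt0; case: k {IHk kn}.
rewrite -(leq_pmul2l kk0); apply: (@leq_trans (k.+1 ^ k * n ^ k)).
  rewrite -!expnMn; have [->|k0] := posnP k; first by rewrite !expn0.
  by rewrite leq_exp2r // mulnS mulSn leq_add2r -ltnS.
by rewrite mulnCA leq_mul2l IHk ?orbT.
Qed.

(** With [m = n.+1 > 1], the base is [1 - 1 / m = (1 + 1 / n)^-1], and
    [1 + 1 / n <= expR (1 / n)]. *)
Lemma expR_N1_le (R : realType) n : expR (- 1) <= (1 - n.+1%:R^-1) ^+ n :> R.
Proof.
case: n => [|n]; first by rewrite expr0 -[leRHS]expR0 ler_expR lerN10.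
have n0 : 0 < n.+1%:R :> R by rewrite ltr0Sn.
rewrite -[X in expR (- X)](mulfV (lt0r_neq0 n0)) -mulrN expRM_natl.
rewrite lerXn2r ?nnegrE ?expR_ge0 //.
  by rewrite subr_ge0 invf_le1 ?ltr0Sn // ler1n.
have -> : 1 - n.+2%:R^-1 = (1 + n.+1%:R^-1)^-1 :> R.
  by rewrite -(natr1 n.+1); field; rewrite nat1r natr1 !pnatr_eq0.
rewrite expRN lef_pV2 ?posrE ?expR_gt0 ?expR_ge1Dx //.
by rewrite addr_gt0 // invr_gt0.
Qed.

(** Only the sets of size [k] are kept; the assumption on [p ^+ k] makes each of
    them maximal, given that it is complete, with probability at least
    [expR (- 1)]. *)
Lemma Gnp_expectation_num_cliques_ge (R : realType) n k (p : R) :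
    0 <= p -> p <= 1 -> (0 < k <= n)%N -> p ^+ k <= n%:R^-1 ->
  expR (- 1) * 'C(n, k)%:R * p ^+ 'C(k, 2) <=
    Gnp_expectation p (fun G : graph n => (num_cliques G)%:R).
Proof.
move=> p0 p1 /andP[k0 kn] pk.
have n0 : (0 < n)%N by apply: leq_trans kn.
have nV1 : n%:R^-1 <= 1 :> R by rewrite invf_le1 ?ltr0n // ler1n.
have nV0 : 0 <= n%:R^-1 :> R by rewrite invr_ge0.
have pk0 : 0 <= p ^+ k by rewrite exprn_ge0.
have maximal_ge : expR (- 1) <= (1 - p ^+ k) ^+ (n - k).
  apply: (le_trans (expR_N1_le R n.-1)); rewrite prednK //.
  apply: (@le_trans _ _ ((1 - n%:R^-1) ^+ (n - k))).
    by apply: ler_wiXn2l; rewrite -?subn1 ?leq_sub2l //; lra.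
  by rewrite lerXn2r ?nnegrE //; lra.
rewrite Gnp_expectation_num_cliques.
apply: (@le_trans _ _ (\sum_(S in [set S : {set 'I_n} | #|S| == k])
    p ^+ 'C(#|S|, 2) * (1 - p ^+ #|S|) ^+ (n - #|S|))).
  rewrite (eq_bigr (fun=> p ^+ 'C(k, 2) * (1 - p ^+ k) ^+ (n - k))); last first.
    by move=> S; rewrite inE => /eqP->.
  rewrite sumr_const card_draws card_ord -[leRHS]mulr_natr [leLHS]mulrAC.
  by rewrite ler_wpM2r // mulrC ler_wpM2l // exprn_ge0.
rewrite [leRHS](bigID (fun S : {set 'I_n} => #|S| == k)) /= -[leLHS]addr0.
apply: lerD; last first.
  apply: sumr_ge0 => S _; rewrite mulr_ge0 ?exprn_ge0 // subr_ge0.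
  exact: exprn_ile1.
rewrite le_eqVlt; apply/orP; left; apply/eqP; apply: eq_bigl => S.
by rewrite inE -card_gt0; case: eqP => [->|]; rewrite ?k0 ?andbF.
Qed.

Lemma bin_ge_expR (R : realType) n k : (0 < k <= n)%N ->
  expR (k%:R * (ln n%:R - ln k%:R)) <= 'C(n, k)%:R :> R.
Proof.
move=> /andP[k0 kn]; have n0 : (0 < n)%N by apply: leq_trans kn.
rewrite mulrBr expRD expRN !expRM_natl !lnK ?posrE ?ltr0n //.
rewrite ler_pdivrMr ?exprn_gt0 ?ltr0n // mulrC.
by rewrite -!natrX -natrM ler_nat expn_le_bin.
Qed.

Lemma expR_ge1Dsqr (R : realType) (x : R) : 0 <= x -> 1 + x ^+ 2 / 2 <= expR x.
Proof. by move/(expR_ge1Dxn 1); rewrite (_ : 2`!%:R = 2). Qed.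

(** * Asymptotic form of the bounds *)

Lemma ln_Gnp_expectation_num_cliques_le (R : realType) n (p : R)
    (L := ln n%:R) (lam := - ln p)
    (E := Gnp_expectation p (fun G : graph n => (num_cliques G)%:R)) :
    0 < p -> p < 1 -> 1 <= L -> 0 < E ->
  2 * lam * ln E <= L ^+ 2 - 2 * L * ln L + (3 * lam + lam ^+ 2 + 2) * L.
Proof.
move=> p0 p1 L1 E0.
have lam0 : 0 < lam by rewrite oppr_gt0 -[ltRHS]ln1 ltr_ln ?posrE.
have L0 : 0 < L by lra.
set l := ln L; have l0 : 0 <= l by apply: ln_ge0.
(* The square produces ln L squared, which is absorbed in the O(L) term. *)
have l2 : l ^+ 2 <= 2 * L.
  have := expR_ge1Dsqr l0; rewrite lnK ?posrE //; lra.
have : ln E <= L + (L - l + lam / 2) ^+ 2 / (2 * lam).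
  rewrite -ler_expR lnK ?posrE //.
  have := Gnp_expectation_num_cliques_le p0 p1 L1.
  by rewrite /lam mulNr mulrN mulNr.
rewrite -(ler_pM2l (_ : 0 < 2 * lam)) ?mulr_gt0 //.
move/le_trans; apply.
rewrite mulrDr [X in _ + X]mulrCA mulfV ?mulr1; last first.
  by rewrite mulf_neq0 ?lt0r_neq0.
have laml : 0 <= lam * l by rewrite mulr_ge0 // ltW.
have lam2 : lam ^+ 2 <= lam ^+ 2 * L by rewrite ler_peMr ?sqr_ge0.
have lam20 : 0 <= lam ^+ 2 by rewrite sqr_ge0.
lra.
Qed.

(** The hypothesis on [L] ensures that the chosen size [k], which is at most
    [L / lam + 1], does not exceed [n = expR L]. *)
Lemma ln_Gnp_expectation_num_cliques_ge (R : realType) n (p : R)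
    (L := ln n%:R) (lam := - ln p)
    (E := Gnp_expectation p (fun G : graph n => (num_cliques G)%:R)) :
    0 < p -> p < 1 -> 1 + 2 / lam <= L ->
  0 < E /\
  L ^+ 2 - 2 * L * ln L - (4 * lam + 2 / lam + 2) * L <= 2 * lam * ln E.
Proof.
move=> p0 p1 L1.
have lam0 : 0 < lam by rewrite oppr_gt0 -[ltRHS]ln1 ltr_ln ?posrE.
have lamV0 : 0 < lam^-1 by rewrite invr_gt0.
have lamV : lam * lam^-1 = 1 by rewrite mulfV ?lt0r_neq0.
have L0 : 0 < L by lra.
have n0 : 0 < n%:R :> R.
  by rewrite ltNge; apply/negP => /ln0; rewrite -/L; lra.
have nE : n%:R = expR L :> R by rewrite lnK.
have Llam0 : 0 <= L / lam by rewrite divr_ge0 // ltW.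
(* The least integer above L / lam, so that p ^ k drops below 1 / n. *)
have [k [k0 kL kL1]] :
    exists k, [/\ (0 < k)%N, L <= lam * k%:R & k%:R <= L / lam + 1].
  have /andP[kle klt] := truncn_itv Llam0.
  exists (Num.truncn (L / lam)).+1; split=> //.
    by rewrite mulrC -ler_pdivrMr // ltW.
  by rewrite -natr1 lerD2r.
have kL2 : lam * (k%:R - 1) <= L.
  by rewrite mulrC -ler_pdivlMr // lerBlDr.
have kn : (0 < k <= n)%N.
  rewrite k0 /= -(ler_nat R) nE; apply: (le_trans kL1).
  apply: le_trans (expR_ge1Dsqr (ltW L0)).
  rewrite addrC lerD2l expr2 -mulrA ler_wpM2l ?(ltW L0) //.
  by rewrite ler_pdivlMr //; lra.
have {}k0 : 0 < k%:R :> R by rewrite ltr0n.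
have pk : p ^+ k <= n%:R^-1.
  by rewrite nE -expRN exprn_ln // ler_expR; rewrite /lam in kL; lra.
have EL : expR (- 1 + k%:R * L / 2 - k%:R * ln k%:R) <= E.
  apply: le_trans (Gnp_expectation_num_cliques_ge (ltW p0) (ltW p1) kn pk).
  rewrite (_ : _ - _ = - 1 + k%:R * (L - ln k%:R) + - (k%:R * L / 2));
    last by lra.
  rewrite !expRD; apply: ler_pM; rewrite ?expR_ge0 ?mulr_ge0 ?expR_ge0 //.
    by rewrite ler_wpM2l ?expR_ge0 // bin_ge_expR.
  rewrite exprn_ln // ler_expR natr_bin2.
  by have := ler_wpM2l (ltW k0) kL2; rewrite /lam; lra.
have E0 : 0 < E by apply: lt_le_trans EL; rewrite expR_gt0.
split=> //; set l := ln L.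
have l0 : 0 <= l by apply: ln_ge0; lra.
have lL : l <= L.
  have := expR_ge1Dx l; rewrite lnK ?posrE //; lra.
have lnk : ln k%:R <= l + lam^-1.
  (* k <= L / lam + 1 <= L * (1 + 1 / lam), as 1 <= L. *)
  apply: (@le_trans _ _ (ln (L * (1 + lam^-1)))).
    rewrite ler_ln ?posrE ?mulr_gt0 //; last by lra.
    by apply: (le_trans kL1); lra.
  by rewrite lnM ?posrE //; [rewrite lerD2l le_ln1Dx; lra|lra].
have : 2 * lam * (- 1 + k%:R * L / 2 - k%:R * ln k%:R) <= 2 * lam * ln E.
  by rewrite ler_pM2l ?mulr_gt0 // -ler_expR lnK.
apply: le_trans.
have lamk : lam * k%:R <= L + lam by lra.
(* The product on the right is L * l + O(L), because l <= L. *)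
have klnk : lam * k%:R * ln k%:R <= (L + lam) * (l + lam^-1).
  apply: (@le_trans _ _ (lam * k%:R * (l + lam^-1))).
    by rewrite ler_pM2l ?mulr_gt0.
  by rewrite ler_wpM2r //; lra.
have kLL := ler_wpM2r (ltW L0) kL.
have laml := ler_wpM2l (ltW lam0) lL.
have lamL : lam <= lam * L by rewrite ler_peMr // ltW //; lra.
lra.
Qed.

Theorem theorem1 (R : realType) (p : R) (hp0 : 0 < p) (hp1 : p < 1) :
  exists (C : R) (n0 : nat), 0 < C /\ (3 <= n0)%N /\
    forall n : nat, (n0 <= n)%N ->
      exists eps : R, `|eps| <= C /\
        Gnp_expectation p (fun G : graph n => (num_cliques G)%:R) =
        n%:R `^ (1 / (- 2 * ln p) * (ln n%:R - 2 * ln (ln n%:R) + eps)).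
Proof.
have lnp : ln p < 0 by rewrite -[ltRHS]ln1 ltr_ln ?posrE.
set lam := - ln p; have lam0 : 0 < lam by rewrite oppr_gt0.
have lamV0 : 0 < 2 / lam by rewrite divr_gt0.
have lam20 : 0 <= lam ^+ 2 by rewrite sqr_ge0.
pose C := 4 * lam + lam ^+ 2 + 2 / lam + 2.
pose n0 := maxn 3 (Num.truncn (expR (1 + 2 / lam))).+1.
exists C, n0; split; first by rewrite /C; lra.
split=> [|n n0n]; first exact: leq_maxl.
have n3 : (3 <= n)%N by apply: leq_trans n0n; apply: leq_maxl.
have npos : 0 < n%:R :> R by rewrite ltr0n (leq_trans _ n3).
have L1 : 1 + 2 / lam <= ln n%:R.
  rewrite -ler_expR lnK ?posrE //.
  apply: (le_trans (ltW (truncnS_gt _))); rewrite ler_nat.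
  by apply: leq_trans n0n; apply: leq_maxr.
have [E0 lower] := ln_Gnp_expectation_num_cliques_ge hp0 hp1 L1.
have L1' : 1 <= ln n%:R :> R by lra.
have upper := ln_Gnp_expectation_num_cliques_le hp0 hp1 L1' E0.
rewrite -/lam in lower upper L1.
set E := Gnp_expectation _ _ in E0 lower upper *.
set L := ln n%:R in L1 L1' lower upper *; have L0 : 0 < L by lra.
(* The witness eps solves the required equation, so its bound is the one on
   the gap between 2 * lam * ln E and its main term, divided by L. *)
have gap : 2 * lam * ln E - (L ^+ 2 - 2 * L * ln L) =
    L * (2 * lam * ln E / L - L + 2 * ln L).
  by field; rewrite lt0r_neq0.
exists (2 * lam * ln E / L - L + 2 * ln L); split.
  rewrite -(ler_pM2l L0) -[X in X * `|_|](gtr0_norm L0) -normrM -gap ler_norml.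
  have lamL : 0 <= lam * L by rewrite mulr_ge0 // ltW.
  have lam2L : 0 <= lam ^+ 2 * L by rewrite mulr_ge0 // ltW.
  have lamVL : 0 <= 2 / lam * L by rewrite mulr_ge0 // ltW.
  by rewrite /C; lra.
rewrite /powR gt_eqF // -/L.
rewrite -[LHS]lnK ?posrE //; congr expR.
by rewrite /lam; field; rewrite lt0r_neq0 // lt_eqF.
Qed.
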